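(* There exists a faithful function $f\in\mathcal F$ such that for every real number $x$ that is rational or a quadratic irrational, the continued $f$-expansion $E_f(x)$ terminates, i.e. $E_f(x)\in\mathcal C_t$.
   Context: For real $x$, $\lfloor x\rfloor$ is the greatest integer $\le x$ and $\{x\}=x-\lfloor x\rfloor$. Let $\mathcal C_i$ be the set of formal infinite integer sequences $[a_0;a_1,a_2,\dots]$ with $a_j\ge1$ for all $j\ge1$, and $\mathcal C_t$ the set of formal finite integer sequences $[a_0;a_1,\dots,a_n]$ ($n\ge0$) with $a_j\ge1$ for $1\le j\le n$ and $a_n\ge2$ if $n\ge1$; put $\mathcal C=\mathcal C_i\cup\mathcal C_t$. Let $\mathcal F$ be the set of strictly decreasing continuous functions $f:(1,\infty)\to(0,1)$ with $\lim_{x\to1^+}f(x)=1$ and $\lim_{x\to+\infty}f(x)=0$, and for $f\in\mathcal F$ let $\phi=f^{-1}:(0,1)\to(1,\infty)$. The expansion function $E_f:\mathbb R\to\mathcal C$: given $x_0\in\mathbb R$, set $a_0=\lfloor x_0\rfloor$; if $x_k$ is not an integer, set $x_{k+1}=\phi(\{x_k\})$ and $a_{k+1}=\lfloor x_{k+1}\rfloor$. If some $x_n$ is an integer (the first such), $E_f(x_0)=[a_0;a_1,\dots,a_n]\in\mathcal C_t$; otherwise $E_f(x_0)=[a_0;a_1,a_2,\dots]\in\mathcal C_i$. The evaluation function $V_f$: on $\mathcal C_t$, $V_f([a_0])=a_0$ and $V_f([a_0;a_1,\dots,a_n])=a_0+f(V_f([a_1;a_2,\dots,a_n]))$; on $\mathcal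 C_i$, $V_f([a_0;a_1,a_2,\dots])=\lim_{n\to\infty}V_f([a_0;a_1,\dots,a_n])$ whenever the limit exists. A function $f\in\mathcal F$ is faithful if $V_f$ is defined on all of $\mathcal C$ and $E_f:\mathbb R\to\mathcal C$ is a bijection with inverse $V_f$. *)

(* Defs.v *)
From HB Require Import structures.
From mathcomp Require Import all_boot all_order all_algebra.
From mathcomp Require Import all_classical all_reals all_analysis.

Set Implicit Arguments.
Unset Strict Implicit.
Unset Printing Implicit Defensive.

Import Order.TTheory GRing.Theory Num.Theory.
Import numFieldNormedType.Exports.

Local Open Scope classical_set_scope.
Local Open Scope ring_scope.

(* [CFinf a] is [a 0; a 1, a 2, ...]; [CFfin a0 s] is [a0; s`_0, s`_1, ...],
   so that the empty [s] gives the one-term sequence [a0]. *)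
Inductive cfseq : Type :=
  | CFinf of (nat -> int)
  | CFfin of int & seq int.

Definition Ci : set cfseq :=
  [set c | exists2 a : nat -> int,
     (forall j, (1 <= j)%N -> 1 <= a j) & c = CFinf a].

Definition Ct : set cfseq :=
  [set c | exists (a0 : int) (s : seq int),
     [/\ forall a : int, a \in s -> 1 <= a,
         s <> [::] -> 2 <= last a0 s
       & c = CFfin a0 s]].

Definition C : set cfseq := Ci `|` Ct.

(* A function (1, +oo) -> (0, 1) is represented by a total function on [R]
   whose values outside (1, +oo) are arbitrary and never used. *)
Definition classF (R : realType) (f : R -> R) : Prop :=
  [/\ set_fun `]1, +oo[ `]0, 1[ f,
      {in `]1, +oo[ &, forall x y, x < y -> f y < f x},
      {in `]1, +oo[, continuous f},
      f x @[x --> 1^'+] --> (1 : R)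
    & f x @[x --> +oo] --> (0 : R)].

(* [phi f y] is the preimage of [y] in (1, +oo) when there is one; it is only
   used for [y] in (0, 1). *)
Definition phi (R : realType) (f : R -> R) : R -> R :=
  'pinv_(fun=> 0) `]1, +oo[ f.

Definition frac (R : realType) (x : R) : R := x - (Num.floor x)%:~R.

(* The sequence x_0, x_1, ...; once some x_k is an integer the later terms
   are junk, and [expansion] ignores them. *)
Definition remainders (R : realType) (f : R -> R) (x0 : R) (k : nat) : R :=
  iter k (fun x => phi f (frac x)) x0.

Definition expansion (R : realType) (f : R -> R) (x0 : R) : cfseq :=
  let a k := Num.floor (remainders f x0 k) in
  match pselect (exists k, remainders f x0 k \is a Num.int) with
  | left h => CFfin (a 0%N) (mkseq (fun k => a k.+1) (ex_minn h))
  | right _ => CFinf a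
  end.

(* Truncating an infinite sequence may leave a last term equal to 1, whose
   evaluation calls for [f 1]; this is read as the limit of [f] at 1 from the
   right, namely 1.  On [Ct] the argument of [f] always exceeds 1. *)
Definition extend1 (R : realType) (f : R -> R) (x : R) : R :=
  if x == 1 then 1 else f x.

Fixpoint eval_fin (R : realType) (f : R -> R) (a0 : int) (s : seq int) : R :=
  match s with
  | [::] => a0%:~R
  | a1 :: s' => a0%:~R + extend1 f (eval_fin f a1 s')
  end.

Definition convergents (R : realType) (f : R -> R) (a : nat -> int) : R^nat :=
  fun n => eval_fin f (a 0%N) (mkseq (fun k => a k.+1) n).

Definition evaluation (R : realType) (f : R -> R) (c : cfseq) : R :=
  match c with
  | CFinf a => limn (convergents f a)
  | CFfin a0 s => eval_fin f a0 s
  end.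

Definition faithful (R : realType) (f : R -> R) : Prop :=
  [/\ classF f,
      forall a, Ci (CFinf a) -> cvgn (convergents f a),
      set_bij [set: R] C (expansion f),
      forall x, evaluation f (expansion f x) = x
    & forall c, C c -> expansion f (evaluation f c) = c].

Definition quadratic_irrational (R : realType) (x : R) : Prop :=
  irrational x /\
  exists a b c : int,
    a != 0 /\ a%:~R * x ^+ 2 + b%:~R * x + c%:~R = 0.

(* Main.v *)
(* If H is an increasing homeomorphism of the line with H (x + n) = H x + n for
   every integer n, then f = H^-1 o (1 / x) o H turns the continued f-expansion
   of x into the regular continued fraction of H x; so f is faithful, and the
   f-expansion of x terminates exactly when H x is rational.  It remains to find
   H sending the countable set of rational and quadratic numbers into the
   rationals.  On [0, 1] take H = id + sum_n e_n b_n, where s_0, s_1, ...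
   enumerates that set, b_n is the distance to {0, 1, s_0, ..., s_(n-1)}, and
   e_n <= 2^-(n+2) is chosen to make the n-th partial sum rational at s_n: later
   terms vanish at s_n, and since b_n is 1-Lipschitz, H - id is 1/2-Lipschitz. *)

From mathcomp Require Import all_boot all_order all_algebra.
From mathcomp Require Import all_classical all_reals all_analysis.
From mathcomp Require Import ring lra zify.
Require Import Defs.

Set Implicit Arguments.
Unset Strict Implicit.
Unset Printing Implicit Defensive.

Import Order.TTheory GRing.Theory Num.Theory.
Import numFieldNormedType.Exports.

Local Open Scope classical_set_scope.
Local Open Scope ring_scope.

(** * Perturbing the identity *)

Section perturbation.
Variables (R : realType) (s : nat -> R).
Implicit Types x y : R.

Fixpoint bump (n : nat) (x : R) : R :=
  if n is m.+1 then Num.min (bump m x) `|x - s m|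
  else Num.min `|x| `|x - 1|.

Lemma lipschitz_min (a b c d e : R) :
  `|a - b| <= e -> `|c - d| <= e -> `|Num.min a c - Num.min b d| <= e.
Proof.
rewrite !ler_norml !minEle => /andP[? ?] /andP[? ?].
by case: (leP a c); case: (leP b d) => ? ?; apply/andP; split; lra.
Qed.

Lemma bump_lipschitz n x y : `|bump n x - bump n y| <= `|x - y|.
Proof.
have dist_lip t : `| `|x - t| - `|y - t| | <= `|x - y|.
  by apply: le_trans (ler_dist_dist _ _) _; rewrite opprB addrA subrK.
elim: n => [|n IHn] /=; apply: lipschitz_min => //.
by have := dist_lip 0; rewrite !subr0.
Qed.

Lemma bump_ge0 n x : 0 <= bump n x.
Proof. by elim: n => [|n IHn] /=; rewrite le_min !normr_ge0 ?IHn. Qed.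

Lemma bump0 n : bump n 0 = 0.
Proof.
elim: n => [|n IHn] /=; first by rewrite normr0 min_l.
by rewrite IHn min_l.
Qed.

Lemma bump1 n : bump n 1 = 0.
Proof.
elim: n => [|n IHn] /=; first by rewrite subrr normr0 min_r.
by rewrite IHn min_l.
Qed.

Lemma bump_node n i : (i < n)%N -> bump n (s i) = 0.
Proof.
elim: n => // n IHn; rewrite ltnS leq_eqVlt => /orP[/eqP->|lt_in] /=.
  by rewrite subrr normr0 min_r ?bump_ge0.
by rewrite IHn // min_l.
Qed.

(** What makes a vanishing bump at [s n] harmless: the node is then 0, 1 or an earlier node, where
    rationality is settled independently. *)
Lemma bump_eq0 n x :
  bump n x = 0 -> [\/ x = 0, x = 1 | exists2 i, (i < n)%N & x = s i].
Proof.
have min_eq0 (a b : R) : Num.min a b = 0 -> a = 0 \/ b = 0.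
  by case: leP => _ ->; [left|right].
elim: n => [|n IHn] /= /min_eq0[].
- by move/normr0_eq0; constructor 1.
- by move/normr0_eq0/subr0_eq; constructor 2.
- move/IHn => [x0|x1|[i lt_in xi]]; [by constructor 1|by constructor 2|].
  by constructor 3; exists i => //; apply: ltnW.
- by move/normr0_eq0/subr0_eq; constructor 3; exists n.
Qed.

(** Density of the rationals between [u] and [u + d * b]; for [b = 0] the choice of [e] has no
    effect and nothing is asked. *)
Lemma rational_translate (u b d : R) : 0 < d -> 0 <= b ->
  exists e, 0 <= e <= d /\ (0 < b -> rational (u + e * b)).
Proof.
move=> d0; rewrite le_eqVlt => /orP[/eqP <-|b0].
  by exists 0; rewrite lexx ltW // ltxx; split.
have [q] : exists q : rat, ratr q \in `]u, u + d * b[.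
  by apply: rat_in_itvoo; rewrite ltrDl mulr_gt0.
rewrite in_itv /= => /andP[uq qd].
exists ((ratr q - u) / b); split.
  rewrite divr_ge0 ?(ltW b0) ?subr_ge0 ?(ltW uq) //= ler_pdivrMr //.
  by rewrite lerBlDl ltW.
by move=> _; exists q => //; rewrite divfK ?gt_eqF // addrC subrK.
Qed.

Lemma exists_perturbation_seq : exists (h : nat -> R -> R) (e : nat -> R),
  [/\ forall x, h 0%N x = x,
      forall n x, h n.+1 x = h n x + e n * bump n x,
      forall n, 0 <= e n <= 2^-1 ^+ n.+2
    & forall n, 0 < bump n (s n) -> rational (h n.+1 (s n))].
Proof.
(* [e n] depends on [h n], built from the earlier [e]. Choosing [eps] for every index and current
   value first leaves a plain recursion on [h]. *)
have /choice[eps epsP] (t : nat * R) : exists e : R, 0 <= e <= 2^-1 ^+ t.1.+2 /\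
    (0 < bump t.1 (s t.1) -> rational (t.2 + e * bump t.1 (s t.1))).
  by apply: rational_translate; [apply: exprn_gt0; lra|exact: bump_ge0].
pose fix h n := if n is m.+1
  then fun x => h m x + eps (m, h m (s m)) * bump m x else id.
exists h, (fun n => eps (n, h n (s n))); split=> //= n.
  by have [] := epsP (n, h n (s n)).
by have [_] := epsP (n, h n (s n)).
Qed.

Lemma exists_perturbation : exists g : R -> R,
  [/\ g 0 = 0, g 1 = 1,
      forall x y, `|(g x - x) - (g y - y)| <= `|x - y| / 2
    & forall i, rational (g (s i))].
Proof.
have [h [e [h0 hS e_itv h_rat]]] := exists_perturbation_seq.
have half0 k : 0 < (2^-1 : R) ^+ k by apply: exprn_gt0; lra.
have fixed x : (forall n, bump n x = 0) -> forall n, h n x = x.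
  by move=> bx; elim=> [|n IHn]; rewrite ?h0 // hS bx mulr0 addr0.
(* The constant is the sum of [2^-(k+2)] over [k < n], the total slope allowed to the first [n]
   bumps. *)
have h_lip n x y : `|(h n x - x) - (h n y - y)|
    <= (2^-1 - 2^-1 ^+ n.+1) * `|x - y|.
  elim: n => [|n IHn].
    by rewrite !h0 !subrr normr0 mul0r.
  rewrite !hS; have := bump_lipschitz n x y; have /andP[] := e_itv n.
  move: (e n) (bump n x) (bump n y) (half0 n) IHn => en bx by_ /ltW.
  rewrite !exprS; set d := 2^-1 ^+ n; set D := `|x - y| => d0 IHn en0 en_le b_le.
  have -> : h n x + en * bx - x - (h n y + en * by_ - y) =
      (h n x - x - (h n y - y)) + en * (bx - by_) by ring.
  apply: le_trans (ler_normD _ _) _; rewrite normrM (ger0_norm en0).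
  have := ler_pM en0 (normr_ge0 _) en_le b_le; lra.
have h_nd x : nondecreasing_seq (h ^~ x).
  apply/nondecreasing_seqP => n; rewrite hS lerDl mulr_ge0 ?bump_ge0 //.
  by have /andP[] := e_itv n.
have h_cvg x : cvgn (h ^~ x).
  apply: nondecreasing_is_cvgn; first exact: h_nd.
  (* Comparison with the fixed point 0 through [h_lip] gives [h n x - x <= |x| / 2]. *)
  exists (x + `|x|) => _ [n _ <-].
  have := h_lip n x 0; rewrite (fixed 0) ?subrr ?subr0; last exact: bump0.
  move/(le_trans (ler_norm _)); have := mulr_ge0 (ltW (half0 n.+1)) (normr_ge0 x).
  by have := normr_ge0 x; lra.
have lim_eq x y N : (forall n, (N <= n)%N -> h n x = y) -> limn (h ^~ x) = y.
  move=> hy; apply: cvg_lim => //; apply: cvg_near_cst.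
  by exists N => // n /= /hy ->.
exists (fun x => limn (h ^~ x)); split.
- by apply: (lim_eq _ _ 0%N) => n _; apply: fixed; exact: bump0.
- by apply: (lim_eq _ _ 0%N) => n _; apply: fixed; exact: bump1.
- move=> x y.
  have /cvg_norm cv : (h n x - x) - (h n y - y) @[n --> \oo] -->
      (limn (h ^~ x) - x) - (limn (h ^~ y) - y).
    by apply: cvgB; apply: cvgB; first [exact: h_cvg|exact: cvg_cst].
  rewrite -(cvg_lim _ cv) //; apply: limr_le; first by apply/cvg_ex; eexists; exact: cv.
  near=> n; apply: le_trans (h_lip n x y) _.
  have := mulr_ge0 (ltW (half0 n.+1)) (normr_ge0 (x - y)); lra.
(* Strong induction, since [s i] may repeat an earlier node. *)
- move=> i; have [m] := ubnP i; elim: m i => // m IHm i lt_im.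
  have [b0|] := ltP 0 (bump i (s i)).
    (* From stage [i.+1] on the value at [s i] is frozen, all later bumps vanishing there. *)
    rewrite (lim_eq _ (h i.+1 (s i)) i.+1); first exact: h_rat.
    elim=> // n IHn; rewrite leq_eqVlt => /orP[/eqP<- //|lt_in].
    by rewrite hS IHn // bump_node // mulr0 addr0.
  rewrite le_eqVlt ltNge bump_ge0 orbF => /eqP/bump_eq0[->|->|[j lt_ji ->]].
  + rewrite (lim_eq _ 0 0%N); first by exists 0 => //; rewrite rmorph0.
    by move=> n _; apply: fixed; exact: bump0.
  + rewrite (lim_eq _ 1 0%N); first by exists 1 => //; rewrite rmorph1.
    by move=> n _; apply: fixed; exact: bump1.
  + by apply: IHm; apply: leq_trans lt_ji _.
Unshelve. all: by end_near.
Qed.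

End perturbation.

(** * Quadratic numbers and the lift of the perturbation to the line *)

Section quadratic.
Variable R : realType.
Implicit Types x y : R.

Lemma frac_itv x : 0 <= frac x < 1.
Proof.
by rewrite /frac subr_ge0 floor_le ltrBlDl; have := floorD1_gt x; rewrite intrD.
Qed.

Lemma fracDz x (a : int) : frac (x + a%:~R) = frac x.
Proof. by rewrite /frac floorDrz ?intr_int // intrKfloor intrD opprD addrACA subrr addr0. Qed.

Lemma floor_intrD (a : int) x : 0 <= x < 1 -> Num.floor (a%:~R + x) = a.
Proof. by move=> /andP[? ?]; apply: floor_def; rewrite intrD; apply/andP; split; lra. Qed.

Lemma frac_intrD (a : int) x : 0 <= x < 1 -> frac (a%:~R + x) = x.
Proof. by move=> x01; rewrite /frac floor_intrD // addrC addKr. Qed.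

(** Completing the square; a rational [x] is the case [p = x], [q = 0]. Pairs of rationals then
    parametrize all these numbers up to a sign. *)
Lemma quadratic_square x : rational x \/ quadratic_irrational x ->
  exists p q : rat, (x - ratr p) ^+ 2 = ratr q.
Proof.
move=> [[p _ <-]|[_ [a [b [c [a0 abc]]]]]].
  by exists p, 0; rewrite subrr expr0n /= [RHS]rmorph0.
exists (- b%:~R / (2 * a%:~R)),
  ((b%:~R ^+ 2 - 4 * a%:~R * c%:~R) / (2 * a%:~R) ^+ 2).
rewrite !(fmorph_div, rmorphN, rmorphXn, rmorphM, rmorphB, ratr_int, rmorph_nat) /=.
have a0R : a%:~R != 0 :> R by rewrite intr_eq0.
apply/eqP; rewrite -subr_eq0; apply/eqP.
transitivity ((a%:~R * x ^+ 2 + b%:~R * x + c%:~R) / a%:~R); last by rewrite abc mul0r.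
by field.
Qed.

(** Fractional parts suffice because the homeomorphism to be built commutes with integer
    translations. *)
Lemma quadratic_frac_enum : exists s : nat -> R,
  forall x, rational x \/ quadratic_irrational x -> exists n, s n = frac x.
Proof.
pose root (t : rat * rat * bool) : R :=
  ratr t.1.1 + (-1) ^+ t.2 * Num.sqrt (ratr t.1.2).
exists (fun n => if unpickle n is Some t then frac (root t) else 0) => x.
move=> /quadratic_square[p [q xpq]].
(* The boolean records the sign of [x - p], which selects the square root. *)
exists (pickle (p, q, x < ratr p)); rewrite pickleK; congr frac.
by rewrite /root /= -xpq sqrtr_sqr -subr_lt0 -numEsign addrC subrK.
Qed.

Lemma lipschitz_continuous (f : R -> R) (k : R) : 0 < k ->
  (forall x y, `|f x - f y| <= k * `|x - y|) -> continuous f.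
Proof.
move=> k0 f_lip x; apply/cvgrPdist_le => e e0; near=> y.
apply: le_trans (f_lip x y) _; rewrite -ler_pdivlMl // mulrC.
near: y; apply: cvgr_dist_le => //; exact: divr_gt0.
Unshelve. all: by end_near.
Qed.

(** The displacement [g - id], zero at 0 and 1, is extended with period 1; its Lipschitz constant
    1/2 keeps the slopes of [H] between 1/2 and 3/2. *)
Lemma exists_homeo (s : nat -> R) : exists H G : R -> R,
  [/\ cancel H G, cancel G H,
      H 0 = 0 /\ forall x (a : int), H (x + a%:~R) = H x + a%:~R,
      forall x y, x <= y -> (y - x) / 2 <= H y - H x <= 2 * (y - x)
    & forall n, 0 <= s n < 1 -> rational (H (s n))].
Proof.
have [g [g0 g1 g_lip g_rat]] := exists_perturbation s.
pose H x := x + (g (frac x) - frac x).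
have HE (a : int) x : 0 <= x < 1 -> H (a%:~R + x) = a%:~R + g x.
  by move=> x01; rewrite /H frac_intrD // addrA addrAC addrK.
have H_lip x y : x <= y -> (y - x) / 2 <= H y - H x <= 2 * (y - x).
  move=> xy; suff : `|(g (frac x) - frac x) - (g (frac y) - frac y)| <= (y - x) / 2.
    by rewrite /H ler_norml => /andP[? ?]; apply/andP; split; lra.
  move: (le_floor xy); rewrite le_eqVlt => /orP[/eqP fxy|].
    apply: le_trans (g_lip _ _) _; rewrite /frac fxy opprB addrA subrK distrC.
    by rewrite ger0_norm ?subr_ge0.
  (* Here an integer separates [x] from [y]. The displacement at each point is at most half the
     distance to the end of its unit cell facing the other point, and these distances add up to at
     most [y - x]. *)
  rewrite -lezD1 -(ler_int R) intrD => fxy.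
  have /andP[? ?] := frac_itv x; have /andP[? ?] := frac_itv y.
  have gx : `|g (frac x) - frac x| <= (1 - frac x) / 2.
    have := g_lip (frac x) 1; rewrite g1 subrr subr0 distrC => /le_trans; apply.
    by rewrite distrC ger0_norm // subr_ge0 ltW.
  have gy : `|g (frac y) - frac y| <= frac y / 2.
    have := g_lip (frac y) 0; rewrite g0 subrr !subr0 => /le_trans; apply.
    by rewrite ger0_norm.
  have xE : x = frac x + (Num.floor x)%:~R by rewrite /frac subrK.
  have yE : y = frac y + (Num.floor y)%:~R by rewrite /frac subrK.
  apply: le_trans (ler_normB _ _) _; lra.
have H_inj : injective H.
  move=> x y; wlog xy : x y / x <= y.
    by case/orP: (le_total x y) => xy wl e; [|apply/esym]; exact: wl.
  by have := H_lip _ _ xy => /andP[? ?] e; apply/le_anti/andP; split; lra.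
have H_surj y : exists x, H x = y.
  have /andP[y0 y1] := frac_itv y.
  have [||c] := @IVT R g 0 1 (frac y) ler01.
  - apply: continuous_subspaceT; apply: (@lipschitz_continuous _ 2) => // u v.
    have := ler_normD ((g u - u) - (g v - v)) (u - v).
    have -> : (g u - u) - (g v - v) + (u - v) = g u - g v by ring.
    by have := g_lip u v; have := normr_ge0 (u - v); lra.
  - by rewrite g0 g1 minEle maxEle ler01 y0 ltW.
  (* [c = 1] would give [frac y = 1]; excluding it makes [c] a fractional part, as [HE] requires. *)
  rewrite in_itv /= => /andP[c0]; rewrite le_eqVlt => /orP[/eqP->|c1 gc].
    by rewrite g1 => ey; move: y1; rewrite -ey ltxx.
  exists ((Num.floor y)%:~R + c); rewrite HE ?c0 // gc.
  by rewrite /frac addrC subrK.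
have [G GK] := choice H_surj.
exists H, G; split=> //.
- by move=> x; apply: H_inj; rewrite GK.
- split; first by have := HE 0 0; rewrite !add0r g0 => -> //; rewrite lexx ltr01.
  by move=> x a; rewrite /H fracDz addrAC.
- move=> n sn; have := HE 0 (s n) sn; rewrite !add0r => ->; exact: g_rat.
Qed.

End quadratic.

(** * Contraction for the Gauss map *)

Section gauss.
Variable R : realType.
Implicit Types (x y u v : R) (a : nat -> int) (f : R -> R).

(** [u] stands for the complete quotient left after [n] digits; keeping it real allows one prefix to
    be compared under different tails. *)
Fixpoint eval_tail f a n u : R :=
  if n is m.+1 then (a 0%N)%:~R + f (eval_tail f (fun k => a k.+1) m u) else u.

Lemma eval_tailD f a m n u : eval_tail f a (m + n) u =
  eval_tail f a m (eval_tail f (fun k => a (m + k)%N) n u).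
Proof. by elim: m a => //= m IHm a; rewrite IHm. Qed.

Lemma eval_inv_ge1 a n u : (forall j, 1 <= a j) -> 1 <= u ->
  1 <= eval_tail GRing.inv a n u.
Proof.
move=> + u1; elim: n a => //= n IHn a a_ge1.
have a1 : 1 <= (a 0%N)%:~R :> R by rewrite ler1z.
by rewrite -[leLHS]addr0 lerD // invr_ge0 (le_trans ler01) // IHn.
Qed.

(** The quantity [|x - y| / ((x + 1) * (y + 1))], the distance in the coordinate [- 1 / (x + 1)], is
    invariant under inversion. *)
Lemma inv_dist_le x y k : 1 <= x -> 1 <= y ->
  `|x - y| <= k * ((x + 1) * (y + 1)) ->
  `|x^-1 - y^-1| <= k * ((1 + x^-1) * (1 + y^-1)).
Proof.
move=> x1 y1 xy_le.
have x0 : 0 < x by lra.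
have y0 : 0 < y by lra.
have -> : x^-1 - y^-1 = - (x - y) * (x^-1 * y^-1) by field; rewrite !gt_eqF.
have -> : k * ((1 + x^-1) * (1 + y^-1)) =
    k * ((x + 1) * (y + 1)) * (x^-1 * y^-1) by field; rewrite !gt_eqF.
have ixy : 0 <= x^-1 * y^-1 by rewrite mulr_ge0 ?invr_ge0 ?ltW.
by rewrite normrM normrN (ger0_norm ixy); exact: ler_wpM2r.
Qed.

(* In the coordinate [- 1 / (x + 1)], each step [x = a + 1 / y] contracts by
   [(1 + 1 / y) / (a + 1 + 1 / y) <= 2 / 3] at both points. *)
Lemma eval_inv_dist a n u v : (forall j, 1 <= a j) -> 1 <= u -> 1 <= v ->
  `|eval_tail GRing.inv a n u - eval_tail GRing.inv a n v| <=
  (4 / 9) ^+ n * `|u - v| * ((eval_tail GRing.inv a n u + 1) *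
                             (eval_tail GRing.inv a n v + 1)).
Proof.
move=> + u1 v1; elim: n a => /= [_ _|n IHn a a_ge1].
  rewrite expr0 mul1r ler_peMr // -[leLHS]mulr1; apply: ler_pM => //; lra.
set b := fun k => a k.+1; have b_ge1 j : 1 <= b j by apply: a_ge1.
have a1 : 1 <= (a 0%N)%:~R :> R by rewrite ler1z.
have := inv_dist_le (eval_inv_ge1 n b_ge1 u1) (eval_inv_ge1 n b_ge1 v1) (IHn b b_ge1).
have := eval_inv_ge1 n b_ge1 u1; have := eval_inv_ge1 n b_ge1 v1.
set X := eval_tail _ b n u; set Y := eval_tail _ b n v => Y1 X1 {}IHn.
have inv01 (z : R) : 1 <= z -> 0 < z^-1 <= 1.
  by move=> z1; rewrite invr_gt0 invf_le1; lra.
rewrite [in leLHS](addrC _ X^-1) addrKA; apply: le_trans IHn _.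
rewrite exprS; set c := _ ^+ _; move: (a 0%N)%:~R a1 => a0 a1.
have step (z : R) : 0 < z <= 1 -> 0 <= 1 + z <= 2 / 3 * (a0 + z + 1) by move=> ?; lra.
have /andP[? ?] := step _ (inv01 _ X1); have /andP[? ?] := step _ (inv01 _ Y1).
have -> : 4 / 9 * c * `|u - v| * ((a0 + X^-1 + 1) * (a0 + Y^-1 + 1)) =
  c * `|u - v| * ((2 / 3 * (a0 + X^-1 + 1)) * (2 / 3 * (a0 + Y^-1 + 1))).
  by field; rewrite !gt_eqF //; lra.
by rewrite ler_wpM2l ?mulr_ge0 ?exprn_ge0 ?ler_pM //; lra.
Qed.

(** [a 0] is arbitrary here, so the bound comes from the shifted digits. The last inversion replaces
    the unbounded factors [X + 1], [Y + 1] by [1 + X^-1], [1 + Y^-1], at most 2 each; the factor 9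
    makes up for the missing power, as [9 * (4 / 9) = 2 * 2]. *)
Lemma eval_inv_contract a n u v :
  (forall j, (1 <= j)%N -> 1 <= a j) -> 1 <= u -> 1 <= v ->
  `|eval_tail GRing.inv a n u - eval_tail GRing.inv a n v| <=
  9 * (4 / 9) ^+ n * `|u - v|.
Proof.
case: n => [|n] a_ge1 u1 v1 /=.
  by rewrite expr0 mulr1 ler_peMl //; lra.
set b := fun k => a k.+1; have b_ge1 j : 1 <= b j by apply: a_ge1.
have := inv_dist_le (eval_inv_ge1 n b_ge1 u1) (eval_inv_ge1 n b_ge1 v1)
                    (eval_inv_dist n b_ge1 u1 v1).
have := eval_inv_ge1 n b_ge1 u1; have := eval_inv_ge1 n b_ge1 v1.
set X := eval_tail _ b n u; set Y := eval_tail _ b n v => Y1 X1 bnd.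
have inv01 (z : R) : 1 <= z -> 0 < z^-1 <= 1.
  by move=> z1; rewrite invr_gt0 invf_le1; lra.
rewrite [in leLHS](addrC _ X^-1) addrKA; apply: le_trans bnd _.
have := inv01 _ X1; have := inv01 _ Y1 => /andP[? ?] /andP[? ?].
rewrite exprS; set c := _ ^+ _.
have -> : 9 * (4 / 9 * c) * `|u - v| = c * `|u - v| * (2 * 2) by field.
by rewrite ler_wpM2l ?mulr_ge0 ?exprn_ge0 ?ler_pM //; lra.
Qed.

End gauss.

(** * Continued f-expansions *)

Section expansion.
Variable R : realType.
Implicit Types (f : R -> R) (x : R).

Lemma expansion_fin f x n : remainders f x n \is a Num.int ->
  (forall k, (k < n)%N -> remainders f x k \isn't a Num.int) ->
  expansion f x =
  CFfin (Num.floor x) (mkseq (fun k => Num.floor (remainders f x k.+1)) n).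
Proof.
move=> xn xk; rewrite /expansion; case: pselect => [h|[]]; last by exists n.
case: ex_minnP => m xm m_min; suff -> : m = n by [].
by apply/eqP; rewrite eqn_leq m_min //= leqNgt; apply/negP => /xk/negP.
Qed.

Lemma expansion_inf f x : (forall k, remainders f x k \isn't a Num.int) ->
  expansion f x = CFinf (fun k => Num.floor (remainders f x k)).
Proof.
move=> xk; rewrite /expansion; case: pselect => // h.
by exfalso; case: h => k; apply/negP.
Qed.

Variant expansion_spec f x : Prop :=
  | ExpansionFin n of remainders f x n \is a Num.int &
      (forall k, (k < n)%N -> remainders f x k \isn't a Num.int)
  | ExpansionInf of forall k, remainders f x k \isn't a Num.int.

Lemma expansionP f x : expansion_spec f x.
Proof.
have [xint|xnint] := pselect (exists k, remainders f x k \is a Num.int).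
  case: (ex_minnP xint) => n xn n_min; apply: (@ExpansionFin _ _ n) => // k.
  by rewrite ltnNge; apply: contraNN => /n_min.
by apply: ExpansionInf => k; apply/negP => xk; apply: xnint; exists k.
Qed.

Lemma remaindersS f x k : remainders f x k.+1 = remainders f (phi f (frac x)) k.
Proof. by rewrite /remainders iterSr. Qed.

Lemma expansion_cons f x b t : x \isn't a Num.int ->
  expansion f (phi f (frac x)) = CFfin b t ->
  expansion f x = CFfin (Num.floor x) (b :: t).
Proof.
move=> xint; case: (expansionP f (phi f (frac x))) => [n yn yk|yk]; last first.
  by rewrite expansion_inf.
rewrite (expansion_fin yn yk) => -[<- <-].
rewrite (@expansion_fin f x n.+1) ?remaindersS //; last first.
  by case=> // k; rewrite remaindersS => /yk.
rewrite /mkseq -[iota 0 n.+1]/(0%N :: iota (1 + 0) n) iotaDl map_cons -map_comp.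
by congr (CFfin _ (_ :: _)); apply: eq_map => k; rewrite -remaindersS.
Qed.

Lemma cvgn_geometric (u : R^nat) (l k q : R) : `|q| < 1 ->
  (forall n, `|l - u n| <= k * q ^+ n) -> u n @[n --> \oo] --> l.
Proof.
move=> q1 u_le; apply/cvgrPdist_le => e e0.
have /cvgrPdist_le/(_ e e0)[N _ qN] := cvg_geometric k q1.
exists N => // n /qN; rewrite /= sub0r normrN; apply: le_trans.
exact: le_trans (u_le n) (ler_norm _).
Qed.

Lemma is_cvgn_geometric (u : R^nat) (k q : R) : `|q| < 1 ->
  (forall n m, (n <= m)%N -> `|u n - u m| <= k * q ^+ n) -> cvgn u.
Proof.
move=> q1 u_le; apply/cauchy_cvgP/cauchy_exP => e e0.
have /cvgrPdist_lt/(_ e e0)[N _ qN] := cvg_geometric k q1.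
exists (u N); exists N => // m /= Nm; rewrite /ball /=.
apply: le_lt_trans (u_le _ _ Nm) _; apply: le_lt_trans (ler_norm _) _.
by have := qN N (leqnn N); rewrite sub0r normrN.
Qed.

End expansion.

(** * The conjugate of inversion by [H] *)

Section conjugate.
Variables (R : realType) (H G : R -> R).
Hypotheses (HK : cancel H G) (GK : cancel G H) (H0 : H 0 = 0).
Hypothesis HDz : forall (x : R) (a : int), H (x + a%:~R) = H x + a%:~R.
Hypothesis H_lip : forall x y : R, x <= y -> (y - x) / 2 <= H y - H x <= 2 * (y - x).
Implicit Types (x y u v : R) (a : nat -> int) (s : seq int).

Definition conj_inv x : R := G (H x)^-1.
Local Notation f := conj_inv.

Let H_int (a : int) : H a%:~R = a%:~R.
Proof. by rewrite -[X in H X]add0r HDz H0 add0r. Qed.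

Let H1 : H 1 = 1. Proof. exact: (H_int 1). Qed.

Let H_lt : {mono H : x y / x < y}.
Proof.
move=> x y; case: (ltP x y) => [xy|yx]; apply/idP.
  by have /andP[? _] := H_lip (ltW xy); lra.
by apply/negP; rewrite -leNgt; have /andP[? _] := H_lip yx; lra.
Qed.

Let H_le : {mono H : x y / x <= y}.
Proof. by move=> x y; rewrite !leNgt H_lt. Qed.

Let G_lt : {mono G : x y / x < y}.
Proof. by move=> x y; rewrite -H_lt !GK. Qed.

Let G0 : G 0 = 0. Proof. by rewrite -[in LHS]H0 HK. Qed.

Let G1 : G 1 = 1. Proof. by rewrite -[in LHS]H1 HK. Qed.

Let H_dist x y : `|x - y| <= 2 * `|H x - H y| /\ `|H x - H y| <= 2 * `|x - y|.
Proof.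
wlog xy : x y / y <= x.
  by case/orP: (le_total x y) => xy wl; [rewrite (distrC x) (distrC (H x))|]; exact: wl.
have /andP[? ?] := H_lip xy; rewrite !ger0_norm ?subr_ge0 ?H_le //; split; lra.
Qed.

Let H_cont : continuous H.
Proof. by apply: (@lipschitz_continuous _ _ 2) => // x y; have [] := H_dist x y. Qed.

Let G_cont : continuous G.
Proof.
apply: (@lipschitz_continuous _ _ 2) => // x y.
by have [] := H_dist (G x) (G y); rewrite !GK.
Qed.

Let H_gt0 x : (0 < H x) = (0 < x). Proof. by rewrite -[in LHS]H0 H_lt. Qed.

Lemma conj_invK : involutive f.
Proof. by move=> x; rewrite /f GK invrK HK. Qed.

Lemma conj_inv1 : f 1 = 1.
Proof. by rewrite /f H1 invr1 G1. Qed.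

Lemma conj_inv_gt0 x : 0 < x -> 0 < f x.
Proof. by move=> x0; rewrite -[ltLHS]G0 G_lt invr_gt0 H_gt0. Qed.

Lemma conj_inv_lt x y : 0 < x -> x < y -> f y < f x.
Proof.
by move=> x0 xy; rewrite G_lt ltf_pV2 ?posrE ?H_gt0 ?H_lt // (lt_trans x0).
Qed.

Lemma conj_inv_lt1 x : 1 < x -> f x < 1.
Proof. by move=> x1; rewrite -conj_inv1 conj_inv_lt. Qed.

Lemma conj_inv_gt1 x : 0 < x < 1 -> 1 < f x.
Proof. by move=> /andP[x0 x1]; rewrite -[ltLHS]conj_inv1 conj_inv_lt. Qed.

Lemma conj_inv_itv x : 1 <= x -> 0 < f x <= 1.
Proof.
rewrite le_eqVlt => /orP[/eqP<-|x1]; first by rewrite conj_inv1 ltr01 lexx.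
by rewrite conj_inv_gt0 ?(lt_trans ltr01) // ltW // conj_inv_lt1.
Qed.

Lemma conj_inv_continuous x : 0 < x -> {for x, continuous f}.
Proof.
move=> x0; apply: (@continuous_comp _ _ _ (fun y => (H y)^-1) G); last exact: G_cont.
by apply: continuousV; [rewrite gt_eqF // H_gt0|exact: H_cont].
Qed.

Lemma classF_conj_inv : classF f.
Proof.
split.
- move=> x; rewrite /= !in_itv /= andbT => x1.
  by rewrite conj_inv_gt0 ?(lt_trans ltr01) // conj_inv_lt1.
- move=> x y; rewrite !in_itv /= !andbT => x1 _; apply: conj_inv_lt.
  exact: lt_trans x1.
- move=> x; rewrite in_itv /= andbT => x1; apply: conj_inv_continuous.
  exact: lt_trans x1.
- rewrite -[X in _ --> X]conj_inv1; apply: cvg_at_right_filter.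
  by apply: conj_inv_continuous.
- rewrite -[X in _ --> X]G0.
  apply: (@cvg_comp _ _ _ (fun x => (H x)^-1) G _ (nbhs (0 : R))); last exact: G_cont.
  apply/gtr0_cvgV0; first by near=> x; rewrite H_gt0; near: x; apply: nbhs_pinfty_gt; exact: num_real.
  apply/cvgryPge => A; near=> x; rewrite -[A]GK H_le.
  by near: x; apply: nbhs_pinfty_ge; exact: num_real.
Unshelve. all: by end_near.
Qed.

(** [f] is an involution exchanging (0, 1) and (1, +oo), hence its own inverse there. *)
Lemma phi_conj_inv x : 0 < x < 1 -> phi f x = f x.
Proof.
move=> x01; rewrite -[in LHS](conj_invK x) /phi pinvKV //.
  move=> y z; rewrite !in_setE /= !in_itv /= !andbT => y1 z1 fyz.
  by rewrite -(conj_invK y) fyz conj_invK.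
by rewrite in_setE /= in_itv /= andbT conj_inv_gt1.
Qed.

(** * Tails, convergents and infinite evaluations *)

(** [H] commutes with integer translations and turns [f] into inversion, so the contraction of
    regular continued fractions transfers to [f]. *)
Lemma conj_inv_tail a n u :
  H (eval_tail f a n u) = eval_tail GRing.inv a n (H u).
Proof.
elim: n a => //= n IHn a.
by rewrite addrC HDz /f GK IHn addrC.
Qed.

(** [36 = 2 * 9 * 2]: the Lipschitz bound 2 for [G], the factor 9 of [eval_inv_contract], and
    [|H u - H v| <= 2] from [|u - v| <= 1]. *)
Lemma conj_inv_contract a n u v : (forall j, (1 <= j)%N -> 1 <= a j) ->
  (a n)%:~R <= u <= (a n)%:~R + 1 -> (a n)%:~R <= v <= (a n)%:~R + 1 ->
  `|eval_tail f a n u - eval_tail f a n v| <= 36 * (4 / 9) ^+ n.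
Proof.
move=> a_ge1 un vn.
have uv : `|u - v| <= 1 by rewrite ler_norml; apply/andP; split; lra.
(* [a 0] need not be positive, so [n = 0] cannot go through [eval_inv_contract]. *)
case: n un vn => [|n] un vn; first by rewrite /= expr0; lra.
have a1 : 1 <= (a n.+1)%:~R :> R by rewrite ler1z a_ge1.
have Hge1 w : (a n.+1)%:~R <= w -> 1 <= H w.
  by move=> aw; rewrite -H1 H_le; apply: le_trans aw.
have [] := H_dist (eval_tail f a n.+1 u) (eval_tail f a n.+1 v).
move=> /le_trans le1 _; apply: le1; rewrite !conj_inv_tail.
have := @eval_inv_contract _ a n.+1 (H u) (H v) a_ge1.
have /andP[au _] := un; have /andP[av _] := vn.
move=> /(_ (Hge1 _ au) (Hge1 _ av)); have [_] := H_dist u v.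
have : 0 <= (4 / 9 : R) ^+ n.+1 by apply: exprn_ge0; lra.
move: (_ ^+ _) => c c0 Huv bnd.
have : 9 * c * `|H u - H v| <= 9 * c * 2 by apply: ler_wpM2l; lra.
lra.
Qed.

(** [f 1 = 1], so the convention of [extend1] agrees with [f] itself. *)
Let extend1E x : extend1 f x = f x.
Proof. by rewrite /extend1; case: eqP => // ->; rewrite conj_inv1. Qed.

Lemma convergents0 a : convergents f a 0 = (a 0%N)%:~R.
Proof. by []. Qed.

Lemma convergentsS a n :
  convergents f a n.+1 = (a 0%N)%:~R + f (convergents f (fun k => a k.+1) n).
Proof.
rewrite /convergents /mkseq /= extend1E -[1%N]/(1 + 0)%N iotaDl -map_comp.
by congr (_ + f (eval_fin _ _ _)); apply: eq_map.
Qed.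

Lemma convergentsE a n : convergents f a n = eval_tail f a n (a n)%:~R.
Proof. by elim: n a => [|n IHn] a //; rewrite convergentsS IHn. Qed.

(** The right end is attained: [n = 1] with [a 1 = 1] gives [a 0 + f 1 = a 0 + 1]. *)
Lemma convergents_itv a n : (forall j, (1 <= j)%N -> 1 <= a j) ->
  (a 0%N)%:~R <= convergents f a n <= (a 0%N)%:~R + 1.
Proof.
elim: n a => [|n IHn] a a_ge1; first by rewrite convergents0 lexx lerDl ler01.
rewrite convergentsS; set b := fun k => a k.+1.
have b1 : 1 <= (b 0%N)%:~R :> R by rewrite ler1z; apply: a_ge1.
have /andP[bx _] := IHn b (fun j _ => a_ge1 j.+1 isT).
by have := conj_inv_itv (le_trans b1 bx); move=> ?; apply/andP; split; lra.
Qed.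

Lemma convergents_cvg a : (forall j, (1 <= j)%N -> 1 <= a j) ->
  cvgn (convergents f a).
Proof.
move=> a_ge1; apply: (@is_cvgn_geometric _ _ 36 (4 / 9)).
  by rewrite ger0_norm; lra.
(* Both convergents share their first [n] digits; the tail of the later one is a convergent of the
   shifted sequence. *)
move=> n m nm; rewrite !convergentsE -(subnKC nm) eval_tailD.
set b := fun k => a (n + k)%N.
have b_ge1 j : (1 <= j)%N -> 1 <= b j by move=> j1; apply: a_ge1; lia.
apply: conj_inv_contract => //; first by rewrite lexx lerDl ler01.
by have := convergents_itv (m - n) b_ge1; rewrite convergentsE /b addn0.
Qed.

(** Continuity of [f] passes the recursion of the convergents to the limit. The strict bound is what
    later lets the digits be recovered. *)
Lemma evaluation_step a : (forall j, (1 <= j)%N -> 1 <= a j) ->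
  evaluation f (CFinf a) =
    (a 0%N)%:~R + f (evaluation f (CFinf (fun k => a k.+1))) /\
  1 < evaluation f (CFinf (fun k => a k.+1)).
Proof.
have ge1 b : (forall j, 1 <= b j) -> 1 <= evaluation f (CFinf b).
  move=> b_ge1; apply: limr_ge; first exact: convergents_cvg.
  near=> n; apply: le_trans (proj1 (andP (convergents_itv n (fun j _ => b_ge1 j)))).
  by rewrite ler1z.
have step b : (forall j, (1 <= j)%N -> 1 <= b j) -> evaluation f (CFinf b) =
    (b 0%N)%:~R + f (evaluation f (CFinf (fun k => b k.+1))).
  move=> b_ge1; set c := fun k => b k.+1.
  have c_ge1 j : 1 <= c j by apply: b_ge1.
  apply: cvg_lim => //; rewrite -cvg_shiftS.
  rewrite (_ : [sequence _]_n = fun n => (b 0%N)%:~R + f (convergents f c n)); last first.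
    by apply/funext => n; exact: convergentsS.
  apply: cvgD; first exact: cvg_cst.
  apply: (@cvg_comp _ _ _ (convergents f c) f _ (nbhs (evaluation f (CFinf c)))).
    by apply: convergents_cvg.
  by apply: conj_inv_continuous; apply: lt_le_trans (ge1 c c_ge1).
move=> a_ge1; split; first exact: step.
(* The limit gives only [1 <=]; unfolding one more digit adds a positive value of [f]. *)
rewrite step; last by move=> j _; apply: a_ge1.
have : 1 <= (a 1%N)%:~R :> R by rewrite ler1z a_ge1.
by have /conj_inv_itv := ge1 (fun k => a k.+2) (fun j => a_ge1 j.+2 isT); lra.
Unshelve. all: by end_near.
Qed.

(** * Expansion and evaluation as inverse maps *)

Lemma nonint_step x : x \isn't a Num.int ->
  1 < phi f (frac x) /\ x = (Num.floor x)%:~R + f (phi f (frac x)).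
Proof.
rewrite intrEfloor => xint; have /andP[x0 x1] := frac_itv x.
have fx : 0 < frac x < 1.
  by rewrite lt_neqAle x0 x1 eq_sym /frac subr_eq0 eq_sym xint.
by rewrite phi_conj_inv // conj_invK conj_inv_gt1 // /frac addrC subrK.
Qed.

(** Undoes one expansion step: as [x > 1], [f x] lies strictly inside (0, 1) and is the fractional
    part. *)
Lemma int_add_conj_inv (b : int) x : 1 < x ->
  [/\ b%:~R + f x \isn't a Num.int, Num.floor (b%:~R + f x) = b
    & phi f (frac (b%:~R + f x)) = x].
Proof.
move=> x1; have x0 := lt_trans ltr01 x1.
have fx : 0 < f x < 1 by rewrite conj_inv_gt0 // conj_inv_lt1.
have fx' : 0 <= f x < 1 by have /andP[/ltW-> ->] := fx.
rewrite intrEfloor floor_intrD // frac_intrD // phi_conj_inv // conj_invK.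
by rewrite -subr_eq0 opprD addrA subrr sub0r oppr_eq0 gt_eqF ?conj_inv_gt0.
Qed.

Lemma digit_ge1 x k : remainders f x k \isn't a Num.int ->
  1 <= Num.floor (remainders f x k.+1).
Proof. by move=> /nonint_step[xk _]; rewrite floor_ge_int ltW. Qed.

Lemma expansion_C x : C (expansion f x).
Proof.
case: (expansionP f x) => [n xn xk|xk].
  rewrite (expansion_fin xn xk); right; exists (Num.floor x).
  exists (mkseq (fun k => Num.floor (remainders f x k.+1)) n); split=> //.
    by move=> b /mapP[k]; rewrite mem_iota => /andP[_ kn] ->; exact/digit_ge1/xk.
  case: n xn xk => // n xn xk _.
  rewrite (last_nth 0) size_mkseq -nth_behead [behead _]/= nth_mkseq //.
  (* The last remainder is an integer greater than 1, so the last digit is at least 2. *)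
  have [+ _] := nonint_step (xk n (ltnSn n)).
  rewrite -[phi _ _]/(remainders f x n.+1) -[X in 1 < X](floorK xn).
  by rewrite ltr1z.
rewrite expansion_inf //; left; exists (fun k => Num.floor (remainders f x k)) => //.
by case=> // j _; apply: digit_ge1.
Qed.

Lemma expansion_tail x n : (forall k, (k < n)%N -> remainders f x k \isn't a Num.int) ->
  x = eval_tail f (fun k => Num.floor (remainders f x k)) n (remainders f x n).
Proof.
elim: n x => [|n IHn] x xk //.
have [_ xE] := nonint_step (xk 0%N isT).
have := IHn (phi f (frac x)); rewrite -remaindersS => {}IHn.
rewrite [LHS]xE IHn; last by move=> k kn; rewrite -remaindersS xk.
by congr (_ + f (eval_tail f _ n _)); apply/funext => k; rewrite -remaindersS.
Qed.

Lemma evaluation_expansion x : evaluation f (expansion f x) = x.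
Proof.
case: (expansionP f x) => [n xn xk|xk].
  rewrite (expansion_fin xn xk) /=.
  (* The final remainder is an integer, equal to its floor, so the last convergent is [x] itself. *)
  have := convergentsE (fun k => Num.floor (remainders f x k)) n.
  by rewrite (floorK xn) -expansion_tail.
rewrite expansion_inf // [LHS](cvg_lim _ (l := x)) //.
apply: (@cvgn_geometric _ _ _ 36 (4 / 9)); first by rewrite ger0_norm; lra.
move=> n; pose a k := Num.floor (remainders f x k).
(* [x] and its [n]-th convergent share [n] digits, with tails the [n]-th remainder and its floor. *)
rewrite -[eval_fin _ _ _]/(convergents f a n) convergentsE {1}(@expansion_tail x n) //.
apply: conj_inv_contract; last by rewrite lexx lerDl ler01.
  by case=> // j _; apply: digit_ge1.
by have /andP[-> /ltW] := floor_itv (remainders f x n); rewrite intrD.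
Qed.

Lemma expansion_evaluation_fin (b : int) s : (forall c, c \in s -> 1 <= c) ->
  (s <> [::] -> 2 <= last b s) -> expansion f (eval_fin f b s) = CFfin b s.
Proof.
(* The bound on the last digit excludes the value 1 for a one-digit tail; for longer ones positivity
   of [f] gives strictness. *)
have gt1 c t : 1 <= c -> (forall d, d \in t -> 1 <= d) -> 2 <= last c t ->
    1 < eval_fin f c t.
  elim: t c => [|d t IHt] c c1 t_ge1 /= t2; first by rewrite ltr1z.
  have : 1 <= c%:~R :> R by rewrite ler1z.
  have t1 : 1 < eval_fin f d t.
    by apply: IHt => // [|e et]; apply: t_ge1; rewrite inE ?eqxx ?et ?orbT.
  by rewrite extend1E; have := conj_inv_gt0 (lt_trans ltr01 t1); lra.
elim: s b => [|c s IHs] b s_ge1 s2.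
  by rewrite (@expansion_fin _ _ _ 0) //= ?intrKfloor //; exact: intr_int.
have s_ge1' d : d \in s -> 1 <= d by move=> ds; apply: s_ge1; rewrite inE ds orbT.
have cs1 : 1 < eval_fin f c s.
  by apply: gt1 => //; [apply: s_ge1; rewrite inE eqxx|exact: s2].
rewrite /= extend1E; have [xint xfl xphi] := int_add_conj_inv b cs1.
rewrite -[in RHS]xfl; apply: expansion_cons => //.
by rewrite xphi IHs // => s0; apply: s2.
Qed.

Lemma expansion_evaluation_inf a : (forall j, (1 <= j)%N -> 1 <= a j) ->
  expansion f (evaluation f (CFinf a)) = CFinf a.
Proof.
(* [x k], the value of the sequence shifted by [k], turns out to be the [k]-th remainder; [step]
   reads the digit [a k] off it. *)
move=> a_ge1; pose x k := evaluation f (CFinf (fun j => a (k + j)%N)).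
have step k : [/\ x k \isn't a Num.int, Num.floor (x k) = a k
                & phi f (frac (x k)) = x k.+1].
  have [] := @evaluation_step (fun j => a (k + j)%N).
    by move=> j j1; apply: a_ge1; lia.
  rewrite addn0 -/(x k) (_ : (fun j => _) = fun j => a (k.+1 + j)%N).
    by move=> -> /(int_add_conj_inv (a k)).
  by apply/funext => j; rewrite addnS.
have rem k : remainders f (evaluation f (CFinf a)) k = x k.
  elim: k => // k IHk; have [_ _ <-] := step k; rewrite -IHk //.
rewrite expansion_inf => [|k]; last by rewrite rem; have [] := step k.
by congr CFinf; apply/funext => k; rewrite rem; have [] := step k.
Qed.

Lemma faithful_conj_inv : faithful f.
Proof.
have expK c : C c -> expansion f (evaluation f c) = c.
  move=> [[a a_ge1 ->]|[b [s [s_ge1 s2 ->]]]].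
    exact: expansion_evaluation_inf.
  exact: expansion_evaluation_fin.
split=> //.
- exact: classF_conj_inv.
- by move=> a [b b_ge1 [->]]; exact: convergents_cvg.
- split.
  + by move=> x _; exact: expansion_C.
  + by move=> x y _ _ xy; rewrite -(evaluation_expansion x) xy evaluation_expansion.
  + by move=> c /expK <-; exists (evaluation f c).
- exact: evaluation_expansion.
Qed.

(* Euclid's algorithm: the denominators of the [H]-images of the remainders
   strictly decrease. *)
Lemma remainders_terminate (q : nat) (p : int) x : (0 < q)%N ->
  H x * q%:R = p%:~R -> exists k, remainders f x k \is a Num.int.
Proof.
elim/ltn_ind: q p x => q IHq p x q0 Hx.
have [xint|xint] := boolP (x \is a Num.int); first by exists 0%N.
have [x1 xE] := nonint_step xint; set y := phi f (frac x) in x1 xE.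
have y0 := lt_trans ltr01 x1.
have Hy0 : 0 < H y by rewrite H_gt0.
have q0R : 0 < q%:R :> R by rewrite ltr0n.
(* With [a] the floor of [x], [1 / H y = H x - a] and [H x = p / q] give [H y = q / r] for
   [r = p - a * q]. Then [H y > 1] yields [0 < r < q]. *)
have Hy : q%:R = H y * (p - Num.floor x * q)%:~R.
  have : H x = (Num.floor x)%:~R + (H y)^-1.
    by rewrite [in LHS]xE addrC HDz /f GK addrC.
  rewrite intrB intrM -Hx -[q%:~R]/(q%:R) => ->.
  by field; rewrite gt_eqF.
case rE : (p - Num.floor x * q) Hy => [r|r] Hy; last first.
  have : 0 < H y * (Negz r)%:~R by rewrite -Hy.
  by rewrite pmulr_rgt0 // ltr0z.
have r0 : (0 < r)%N.
  have : 0 < H y * (Posz r)%:~R by rewrite -Hy.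
  by rewrite pmulr_rgt0 // ltr0z.
have rq : (r < q)%N.
  rewrite -(ltr_nat R) Hy -[r%:~R]/(r%:R) ltr_pMl ?ltr0n //.
  by rewrite -H1 H_lt.
have [//|k yk] := IHq r rq q y r0.
by exists k.+1; rewrite remaindersS.
Qed.

Lemma expansion_Ct x : rational (H x) -> Ct (expansion f x).
Proof.
move=> [q _ qE].
have [k xk] : exists k, remainders f x k \is a Num.int.
  apply: (@remainders_terminate `|denq q|%N (numq q)); first by rewrite absz_gt0 denq_neq0.
  by rewrite -qE /ratr pmulrn absz_denq divfK // intr_eq0 denq_neq0.
have [[a a_ge1]|//] := expansion_C x.
by case: (expansionP f x) => [n xn xk'|/(_ k)/negP //]; rewrite (expansion_fin xn xk').
Qed.

End conjugate.

Theorem theorem2 (R : realType) :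
  exists f : R -> R,
    faithful f /\
    forall x : R, rational x \/ quadratic_irrational x -> Ct (expansion f x).
Proof.
have [s s_frac] := quadratic_frac_enum R.
have [H [G [HK GK [H0 HDz] H_lip H_rat]]] := exists_homeo s.
exists (conj_inv H G); split; first exact: faithful_conj_inv.
move=> x /s_frac[n snx]; apply: expansion_Ct => //.
have [|q _ qE] := H_rat n; first by rewrite snx frac_itv.
(* Integer translation carries rationality from [H (frac x)] to [H x]. *)
exists (q + (Num.floor x)%:~R) => //.
by rewrite rmorphD /= ratr_int qE -HDz snx /frac subrK.
Qed.
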